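(* Let $R$, $R'$ and $S$ be TRSs over $\Sigma$ and $T\subseteq\mathcal{T}(\Sigma,\emptyset)$. Let $\mathcal{A}=(A,[\![\cdot]\!],\ge)$ be a monotone partial model for $R\cup R'\cup S$ with $T\subseteq\mathcal{L}(\mathcal{A})$ such that for all rules $\ell\to r\in R'$ and all $\alpha:\mathrm{Var}(\ell)\to A$ the interpretation $[\![\ell]\!]_\alpha$ is undefined. Then if $R$ is terminating relative to $S$ on $T$, also $R\cup R'$ is terminating relative to $S$ on $T$.
   Context: TRS: set of rules $\ell\to r$ ($\ell\notin\mathcal{X}$, $\mathrm{Var}(r)\subseteq\mathrm{Var}(\ell)$). $P$ is terminating relative to $Q$ on $T$ if $\to_Q^*\cdot\to_P\cdot\to_Q^*$ admits no infinite sequence starting in $T$. Partial $\Sigma$-algebra $(A,[\![\cdot]\!])$: partial $[\![f]\!]:A^n\rightharpoonup A$; $[\![x]\!]_\alpha=\alpha(x)$, $[\![f(t_1,..,t_n)]\!]_\alpha=[\![f]\!]([\![t_1]\!]_\alpha,..,[\![t_n]\!]_\alpha)$, defined only if all subexpressions are; $\mathcal{L}(\mathcal{A})$ = ground terms $t$ with $[\![t]\!]$ defined. $(A,[\![\cdot]\!],\ge)$ is a monotone partial model for a TRS $P$ if each $[\![f]\!]$ is closed w.r.t. $\ge$ ($f(\dots,a,\dots)$ defined and $a\ge b$ imply $f(\dots,b,\dots)$ defined) and monotone w.r.t. $\ge$ (if both defined and $a\ge b$ then $f(\dots,a,\dots)\ge f(\dots,b,\dots)$), and for all $\ell\to r\in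 P$ and $\alpha:\mathrm{Var}(\ell)\to A$ with $[\![\ell]\!]_\alpha$ defined, $[\![\ell]\!]_\alpha\ge[\![r]\!]_\alpha$ (both defined). *)

(* Defs.v *)
From Stdlib Require Import Relation_Operators.
From mathcomp Require Import all_boot.

Set Implicit Arguments.
Unset Strict Implicit.
Unset Printing Implicit Defensive.

Definition upd (B : Type) (n : nat) (bs : {ffun 'I_n -> B}) (i : 'I_n) (b : B) :
    {ffun 'I_n -> B} :=
  [ffun j => if j == i then b else bs j].

Record signature := Signature { symb :> Type; arity : symb -> nat }.

Inductive term (Sig : signature) (V : Type) : Type :=
| Var (x : V)
| App (f : Sig) (ts : {ffun 'I_(arity f) -> term Sig V}).

Arguments Var Sig {V} x.
Arguments App {Sig V} f ts.

Section Rewriting.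
Variables (Sig : signature) (V : Type).
Local Notation term := (term Sig V).

Fixpoint occurs (x : V) (t : term) : Prop :=
  match t with
  | Var y => y = x
  | App f ts => exists i, occurs x (ts i)
  end.

Definition ground (t : term) : Prop := forall x, ~ occurs x t.

Fixpoint subst (sigma : V -> term) (t : term) : term :=
  match t with
  | Var x => sigma x
  | App f ts => App f [ffun i => subst sigma (ts i)]
  end.

Record trs := Trs {
  rule :> term -> term -> Prop;
  lhs_nonvar : forall l r, rule l r -> forall x, l <> Var Sig x;
  rhs_vars : forall l r, rule l r -> forall x, occurs x r -> occurs x l }.

Definition trsU (P Q : trs) : trs.
Proof.
refine (@Trs (fun l r => P l r \/ Q l r) _ _).
- by move=> l r [] /lhs_nonvar.
- by move=> l r [] /rhs_vars.
Defined.

Inductive rstep (P : trs) : term -> term -> Prop :=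
| rstep_root l r (sigma : V -> term) :
    P l r -> rstep P (subst sigma l) (subst sigma r)
| rstep_arg f (ts : {ffun 'I_(arity f) -> term}) i t' :
    rstep P (ts i) t' -> rstep P (App f ts) (App f (upd ts i t')).

Definition relstep (P Q : trs) (s t : term) : Prop :=
  exists u v, [/\ clos_refl_trans _ (rstep Q) s u, rstep P u v
                & clos_refl_trans _ (rstep Q) v t].

Definition terminating_relative (P Q : trs) (T : term -> Prop) : Prop :=
  ~ exists s : nat -> term, T (s 0) /\ forall n, relstep P Q (s n) (s n.+1).

End Rewriting.

(* [op f bs = None] means that the operation of [f] is undefined at [bs]. *)
Record partial_algebra (Sig : signature) := PartialAlgebra {
  carrier :> Type;
  op : forall f : Sig, {ffun 'I_(arity f) -> carrier} -> option carrier }.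

Arguments op {Sig} p f bs : rename.

Definition some_val (B : Type) (o : option B) : isSome o -> B :=
  match o with
  | Some b => fun=> b
  | None => fun h => False_rect B (notF h)
  end.

Definition all_some (B : Type) (n : nat) (os : 'I_n -> option B) :
    option {ffun 'I_n -> B} :=
  match @forallP _ (fun i => isSome (os i)) with
  | ReflectT h => Some [ffun i => some_val (h i)]
  | ReflectF _ => None
  end.

Section PartialModels.
Variables (Sig : signature) (V : Type) (A : partial_algebra Sig).

Fixpoint interp (alpha : V -> option A) (t : term Sig V) : option A :=
  match t with
  | Var x => alpha x
  | App f ts => obind (op A f) (all_some (fun i => interp alpha (ts i)))
  end.

(* A function from Var(t) to A is encoded as a partial function on V whose
   domain is exactly Var(t); in particular the one from Var(t) = {} to A is
   [fun=> None]. *)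
Definition assignment_on (t : term Sig V) (alpha : V -> option A) : Prop :=
  forall x, isSome (alpha x) <-> occurs x t.

Definition language (t : term Sig V) : Prop :=
  ground t /\ isSome (interp (fun=> None) t).

Variable ge : A -> A -> Prop.

Definition closed_wrt : Prop :=
  forall (f : Sig) (bs : {ffun 'I_(arity f) -> A}) (i : 'I_(arity f)) (b : A),
    isSome (op A f bs) -> ge (bs i) b -> isSome (op A f (upd bs i b)).

Definition monotone_wrt : Prop :=
  forall (f : Sig) (bs : {ffun 'I_(arity f) -> A}) (i : 'I_(arity f))
         (b c d : A),
    op A f bs = Some c -> op A f (upd bs i b) = Some d ->
    ge (bs i) b -> ge c d.

Definition monotone_partial_model (P : trs Sig V) : Prop :=
  [/\ closed_wrt, monotone_wrt
    & forall l r, P l r -> forall alpha, assignment_on l alpha ->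
      forall a, interp alpha l = Some a ->
      exists2 b, interp alpha r = Some b & ge a b].

End PartialModels.

(* Main.v *)
Require Import Defs.
From Stdlib Require Import Relation_Operators Operators_Properties.
From mathcomp Require Import all_boot.
From Stdlib Require Import ClassicalEpsilon.

(** Rewriting with rules of a monotone partial model preserves definedness of
    the interpretation, so every term reachable from [T] is defined.  A term
    containing an instance of a left-hand side of [R'] is undefined, hence no
    [R']-step is ever taken from [T], and every relative [R U R']-sequence from
    [T] is already a relative [R]-sequence. *)

Set Implicit Arguments.
Unset Strict Implicit.
Unset Printing Implicit Defensive.

(* The induction principle generated for [term] has no hypotheses for the
   subterms hidden under [{ffun _ -> _}]. *)
Fixpoint term_ind_args (Sig : signature) (V : Type) (P : term Sig V -> Prop)
    (PVar : forall x, P (Var Sig x))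
    (PApp : forall (f : Sig) (ts : {ffun 'I_(arity f) -> term Sig V}),
       (forall i, P (ts i)) -> P (App f ts))
    (t : term Sig V) : P t :=
  match t with
  | Var x => PVar x
  | App f ts => PApp f ts (fun i => term_ind_args PVar PApp (ts i))
  end.

Lemma some_valK (B : Type) (o : option B) (h : isSome o) : Some (some_val h) = o.
Proof. by case: o h. Qed.

Lemma all_someP (B : Type) (n : nat) (os : 'I_n -> option B) (bs : {ffun 'I_n -> B}) :
  all_some os = Some bs <-> forall i, os i = Some (bs i).
Proof.
rewrite /all_some; case: forallP => [h|nh]; split=> //.
- by move=> [<-] i; rewrite ffunE some_valK.
- move=> eq_os; congr Some; apply/ffunP=> i; rewrite ffunE.
  by apply: Some_inj; rewrite some_valK.
- by move=> eq_os; case: nh => i; rewrite eq_os.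
Qed.

Lemma eq_all_some (B : Type) (n : nat) (os os' : 'I_n -> option B) :
  os =1 os' -> all_some os = all_some os'.
Proof.
move=> eq_os; case os'E: (all_some os') => [bs|].
  by apply/all_someP => i; rewrite eq_os; move/all_someP: os'E.
case osE: (all_some os) => [bs|] //.
by rewrite -os'E; apply/esym/all_someP => i; rewrite -eq_os; move/all_someP: osE.
Qed.

Section RelativeTermination.
Variables (Sig : signature) (V : Type).
Implicit Types (P Q : trs Sig V) (D T : term Sig V -> Prop) (s t : term Sig V).

Definition rstep_closed P D : Prop := forall s t, rstep P s t -> D s -> D t.

Lemma rsteps_closed P D s t :
  rstep_closed P D -> clos_refl_trans _ (rstep P) s t -> D s -> D t.
Proof.
move=> closedP st Ds; elim/clos_refl_trans_ind_left: st => // u v _ Du uv.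
exact: closedP uv Du.
Qed.

Lemma rstep_trsU P Q s t : rstep (trsU P Q) s t -> rstep P s t \/ rstep Q s t.
Proof.
elim=> {s t} [l r sigma []|f ts i t' _ []] st.
- by left; apply: rstep_root.
- by right; apply: rstep_root.
- by left; apply: rstep_arg.
- by right; apply: rstep_arg.
Qed.

Section ClosedSet.
Variables (P P' Q : trs Sig V) (D : term Sig V -> Prop).
Hypotheses (closedP' : rstep_closed P' D) (closedQ : rstep_closed Q D).
Hypothesis subP'P : forall s t, D s -> rstep P' s t -> rstep P s t.

Lemma sub_relstep_on s t : D s -> relstep P' Q s t -> relstep P Q s t /\ D t.
Proof.
move=> Ds [u [v [su uv vt]]].
have Du : D u := rsteps_closed closedQ su Ds.
split; first by exists u, v; split=> //; apply: subP'P.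
exact: rsteps_closed closedQ vt (closedP' uv Du).
Qed.

Lemma sub_terminating_relative_on T : (forall t, T t -> D t) ->
  terminating_relative P Q T -> terminating_relative P' Q T.
Proof.
move=> subTD termP [s [T_s0 steps]]; apply: termP; exists s; split=> // n.
have Ds k : D (s k).
  by elim: k => [|k /sub_relstep_on/(_ (steps k))[]]; first exact: subTD.
by have [] := sub_relstep_on (Ds n) (steps n).
Qed.

End ClosedSet.

End RelativeTermination.

Section Interpretation.
Variables (Sig : signature) (V : Type) (A : partial_algebra Sig).
Implicit Types (alpha beta : V -> option A) (t u : term Sig V).

Definition defined alpha t : bool := isSome (interp alpha t).

Lemma interp_AppP alpha f (ts : {ffun 'I_(arity f) -> term Sig V}) a :
  interp alpha (App f ts) = Some a <->
  exists2 bs : {ffun 'I_(arity f) -> A},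
    forall i, interp alpha (ts i) = Some (bs i) & op A f bs = Some a.
Proof.
rewrite /=; split=> [|[bs /all_someP -> //]].
by case ts_bs: (all_some _) => [bs|] //= op_bs; exists bs => //; apply/all_someP.
Qed.

Lemma eq_in_interp alpha beta t :
  (forall x, occurs x t -> alpha x = beta x) -> interp alpha t = interp beta t.
Proof.
elim/term_ind_args: t => [x|f ts IH] /= eq_ab; first exact: eq_ab.
congr obind; apply: eq_all_some => i.
by apply: IH => x x_ti; apply: eq_ab; exists i.
Qed.

Lemma interp_subst alpha sigma t :
  interp alpha (subst sigma t) = interp (fun x => interp alpha (sigma x)) t.
Proof.
elim/term_ind_args: t => [x|f ts IH] //=.
by congr obind; apply: eq_all_some => i; rewrite ffunE.
Qed.

Lemma defined_occurs alpha t x :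
  defined alpha t -> occurs x t -> isSome (alpha x).
Proof.
rewrite /defined; elim/term_ind_args: t => [y|f ts IH] /= def_t.
  by move=> <-.
case=> i; apply: IH; case ts_bs: (all_some _) def_t => [bs|] // _.
by move/all_someP: ts_bs => ->.
Qed.

(* The conditions on rules only concern assignments with domain exactly Var(l),
   whereas the substitution of a rewrite step may be defined on more variables. *)
Definition restrict_to t alpha : V -> option A :=
  fun x => if excluded_middle_informative (occurs x t) then alpha x else None.

Lemma assignment_on_restrict_to alpha t :
  defined alpha t -> assignment_on t (restrict_to t alpha).
Proof.
move=> def_t x; rewrite /restrict_to.
case: excluded_middle_informative => // x_t; split=> // _.
exact: defined_occurs x_t.
Qed.

Lemma interp_restrict_to alpha t u :
  (forall x, occurs x u -> occurs x t) ->
  interp (restrict_to t alpha) u = interp alpha u.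
Proof.
move=> sub_ut; apply: eq_in_interp => x /sub_ut x_t.
by rewrite /restrict_to; case: excluded_middle_informative.
Qed.

Lemma interp_undef_assignment_on alpha t :
  (forall beta, assignment_on t beta -> interp beta t = None) ->
  interp alpha t = None.
Proof.
move=> undef; case t_a: (interp alpha t) => [a|] //.
rewrite -t_a -(@interp_restrict_to _ t) //.
by apply/undef/assignment_on_restrict_to; rewrite /defined t_a.
Qed.

Lemma rstep_undef (P : trs Sig V) alpha t u :
  (forall l r, P l r -> forall beta, assignment_on l beta -> interp beta l = None) ->
  rstep P t u -> interp alpha t = None.
Proof.
move=> undef; elim=> {t u} [l r sigma lr|f ts i t' _ IH].
  by rewrite interp_subst; apply: interp_undef_assignment_on (undef _ _ lr).
case ts_a: (interp _ _) => [a|] //.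
by have /interp_AppP[bs /(_ i)] := ts_a; rewrite IH.
Qed.

End Interpretation.

Section MonotonePartialModel.
Variables (Sig : signature) (V : Type) (A : partial_algebra Sig).
Variable ge : A -> A -> Prop.
Implicit Types (alpha : V -> option A) (P Q : trs Sig V) (s t : term Sig V).

Lemma sub_monotone_partial_model P Q :
  (forall l r, P l r -> Q l r) ->
  monotone_partial_model ge Q -> monotone_partial_model ge P.
Proof. by move=> PQ [closed mono rules]; split=> // l r /PQ; apply: rules. Qed.

Lemma interp_rule P alpha l r a :
  monotone_partial_model ge P -> P l r -> interp alpha l = Some a ->
  exists2 b, interp alpha r = Some b & ge a b.
Proof.
case=> _ _ rules lr l_a; rewrite -(interp_restrict_to _ (rhs_vars lr)).
apply: (rules _ _ lr); last by rewrite interp_restrict_to.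
by apply: assignment_on_restrict_to; rewrite /defined l_a.
Qed.

Lemma interp_App_upd alpha f (ts : {ffun 'I_(arity f) -> term Sig V}) i t a :
  closed_wrt ge -> monotone_wrt ge -> interp alpha (App f ts) = Some a ->
  (forall b, interp alpha (ts i) = Some b ->
     exists2 c, interp alpha t = Some c & ge b c) ->
  exists2 d, interp alpha (App f (upd ts i t)) = Some d & ge a d.
Proof.
move=> closed mono /interp_AppP[bs ts_bs op_bs] /(_ _ (ts_bs i))[c t_c ge_c].
have /closed/(_ ge_c) : isSome (op A f bs) by rewrite op_bs.
case op_upd: (op A f (upd bs i c)) => [d|] // _.
exists d; last exact: mono op_bs op_upd ge_c.
apply/interp_AppP; exists (upd bs i c) => // j.
by rewrite !ffunE; case: eqP.
Qed.

Lemma rstep_interp P alpha s t a :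
  monotone_partial_model ge P -> rstep P s t -> interp alpha s = Some a ->
  exists2 b, interp alpha t = Some b & ge a b.
Proof.
move=> model st; have [closed mono _] := model.
elim: st a => {s t} [l r sigma lr|f ts i t' _ IH] a.
  by rewrite !interp_subst; apply: interp_rule model lr.
by move=> /interp_App_upd; apply.
Qed.

Lemma rstep_closed_defined P alpha :
  monotone_partial_model ge P -> rstep_closed P (defined alpha).
Proof.
rewrite /defined => model s t st.
case s_a: (interp alpha s) => [a|] // _.
by have [b ->] := rstep_interp model st s_a.
Qed.

End MonotonePartialModel.

Theorem theorem9p8 (Sig : signature) (V : Type) (R R' S : trs Sig V)
    (T : term Sig V -> Prop) (T_ground : forall t, T t -> ground t)
    (A : partial_algebra Sig) (ge : A -> A -> Prop)
    (model : monotone_partial_model ge (trsU (trsU R R') S))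
    (T_lang : forall t, T t -> language A t)
    (R'_undef : forall l r, R' l r ->
       forall alpha : V -> option A, assignment_on l alpha ->
       interp alpha l = None) :
  terminating_relative R S T -> terminating_relative (trsU R R') S T.
Proof.
pose D := defined (fun=> None : option A) : term Sig V -> bool.
apply: (@sub_terminating_relative_on _ _ _ _ _ D).
- by apply: rstep_closed_defined (sub_monotone_partial_model _ model); left.
- by apply: rstep_closed_defined (sub_monotone_partial_model _ model); right.
- move=> s t D_s /rstep_trsU[//|/(rstep_undef (fun=> None) R'_undef) s_undef].
  by rewrite /D /defined s_undef in D_s.
- by move=> t /T_lang[].
Qed.
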